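(* Let $n$ be an index with $1\le n\le N_\infty$. Let $u_{*,n}\in V$ with $|u_{*,n}|_b=1$ be arbitrary and let $\lambda_{*,n}\in\mathbb{R}$ satisfy the closeness condition $$\sqrt{\lambda_{n-1}\lambda_n}\le \lambda_{*,n}\le \sqrt{\lambda_n\lambda_{n+1}}.$$ Let $w_n\in V$ be the unique element satisfying $$a(w_n,v)=a(u_{*,n},v)-\lambda_{*,n}\,b(u_{*,n},v)\quad\forall v\in V,$$ and let $\eta_n\in\mathbb{R}$ satisfy $\|w_n\|_a\le\eta_n$. Then $$\ell_n:=\frac14\left(-\eta_n+\sqrt{\eta_n^2+4\lambda_{*,n}}\right)^2$$ satisfies $\ell_n\le\lambda_n$.
   Context: $V$ is a real Hilbert space with scalar product $a(\cdot,\cdot)$ and norm $\|v\|_a=a(v,v)^{1/2}$. The form $b(\cdot,\cdot)$ on $V$ is continuous, bilinear, symmetric and positive semidefinite, with seminorm $|v|_b=b(v,v)^{1/2}$. The seminorm $|\cdot|_b$ is assumed compact with respect to $\|\cdot\|_a$: from any sequence bounded in $\|\cdot\|_a$ one can extract a subsequence which is Cauchy in $|\cdot|_b$. The eigenvalue problem is: find $\lambda_i\in\mathbb{R}$ and $u_i\in V\setminus\{0\}$ with $a(u_i,v)=\lambda_i b(u_i,v)$ for all $v\in V$. Its eigenvalues, repeated according to multiplicity, form an at most countable nondecreasing sequence $0<\lambda_1\le\lambda_2\le\cdots$; $N_\infty\in\{0,1,2,\dots\}\cup\{\infty\}$ denotes their number. Conventions for the closeness condition: $\lambda_0:=0$,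 and $\lambda_{n+1}:=+\infty$ if $n=N_\infty<\infty$. *)

(* Defs.v *)
From HB Require Import structures.
From mathcomp Require Import all_boot all_order all_algebra.
From mathcomp Require Import all_classical all_reals all_analysis.
Import Order.TTheory GRing.Theory Num.Theory numFieldNormedType.Exports.

Set Implicit Arguments.
Unset Strict Implicit.
Unset Printing Implicit Defensive.

Local Open Scope classical_set_scope.
Local Open Scope card_scope.
Local Open Scope ring_scope.

(* A real Hilbert space is rendered as V : completeNormedModType R together
   with a dot product a : {dot V for idfun} such that induces_norm a holds. *)

Definition form_norm (R : realType) (V : lmodType R) (f : V -> V -> R)
    (v : V) : R :=
  Num.sqrt (f v v).

Definition induces_norm (R : realType) (V : normedModType R)
    (a : V -> V -> R) : Prop :=
  forall v : V, `|v| = form_norm a v.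

Definition positive_semidefinite (R : realType) (V : lmodType R)
    (b : V -> V -> R) : Prop :=
  forall v : V, 0 <= b v v.

Definition continuous_form (R : realType) (V : normedModType R)
    (b : V -> V -> R) : Prop :=
  continuous (fun p : V * V => b p.1 p.2).

Definition compact_seminorm (R : realType) (V : normedModType R)
    (b : V -> V -> R) : Prop :=
  forall x : nat -> V, (exists M : R, forall k, `|x k| <= M) ->
  exists phi : nat -> nat, {homo phi : i j / (i < j)%N} /\
    forall e : R, 0 < e -> exists K : nat, forall i j : nat,
      (K <= i)%N -> (K <= j)%N -> form_norm b (x (phi i) - x (phi j)) < e.

Definition eig_space (R : realType) (V : lmodType R) (a b : V -> V -> R)
    (mu : R) : set V :=
  [set u | forall v, a u v = mu * b u v].

Definition is_eigenvalue (R : realType) (V : lmodType R) (a b : V -> V -> R)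
    (mu : R) : Prop :=
  exists2 u : V, u != 0 & eig_space a b mu u.

(* V may be infinite dimensional, so the library's \dim (for vectType) does
   not apply. *)
Definition has_dim (R : realType) (V : lmodType R) (E : set V) (m : nat)
    : Prop :=
  exists e : 'I_m -> V,
    (forall c : 'I_m -> R, \sum_(i < m) c i *: e i = 0 -> forall i, c i = 0) /\
    E = [set \sum_(i < m) c i *: e i | c in [set: 'I_m -> R]].

(* The number of eigenvalues is N : option nat, where None stands for
   infinity; eigenvalues are indexed from 1, so lam 0 is irrelevant. *)
Definition eig_index (N : option nat) (i : nat) : bool :=
  (0 < i)%N && (if N is Some k then (i <= k)%N else true).

(* Positivity of the lam i is not required here: it follows from
   a u u = mu * b u u for an eigenvector u. *)
Definition eigenvalue_sequence (R : realType) (V : lmodType R)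
    (a b : V -> V -> R) (N : option nat) (lam : nat -> R) : Prop :=
  [/\ forall i j, eig_index N i -> eig_index N j -> (i <= j)%N ->
        lam i <= lam j,
      forall i, eig_index N i -> is_eigenvalue a b (lam i) &
      forall mu, is_eigenvalue a b mu ->
        exists2 m : nat, has_dim (eig_space a b mu) m &
          [set i | eig_index N i /\ lam i = mu] #= `I_m].

Definition ext_eigenvalue (R : realType) (N : option nat) (lam : nat -> R)
    (i : nat) : \bar R :=
  if i == 0%N then 0%E
  else if eig_index N i then (lam i)%:E else +oo%E.

(* Main.v *)
Require Import Defs.
From HB Require Import structures.
From mathcomp Require Import all_boot all_order all_algebra.
From mathcomp Require Import all_classical all_reals all_analysis.
From mathcomp Require Import ring lra.
Import Order.TTheory GRing.Theory Num.Theory numFieldNormedType.Exports.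

Local Open Scope classical_set_scope.
Local Open Scope ring_scope.

Set Implicit Arguments.
Unset Strict Implicit.
Unset Printing Implicit Defensive.

(** Let T be the operator defined by a (T u) v = b u v.  The eigenvalues of the
    problem are the inverses of the nonzero ones of T, and
    w = us - lams * T us.  The component of w along an eigenvector of eigenvalue
    mu is that of us times 1 - lams / mu, so that a w w is at least the sum of
    the squares of the b-coefficients of us, of total 1, weighted by
    (mu - lams) ^ 2 / mu.  Let lams > 0, the bound being 0 for lams = 0.  As a
    function of mu > 0 the weight takes the same value at lam n and at
    lams ^ 2 / lam n, is smaller between these two points and larger outside.  Closeness says
    that no eigenvalue lies strictly between them, hence
    (lam n - lams) ^ 2 / lam n <= a w w <= eta ^ 2, and solving for the square
    root of lam n gives the bound.

    The eigenvector expansion is not needed in full.  With alpha <= beta the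
    two points above, the inequality says that (1 - alpha T)(1 - beta T) is
    positive semidefinite (defect_ge).  Only finitely many eigenvalues lie
    below the gap, and their eigenspaces are split off one at a time
    (deflation_ind).  On the orthogonal complement of these eigenspaces the
    Rayleigh quotient a u u / b u u is at least beta (rayleigh_ge), which is
    enough to conclude (spectral_gap_form_ge0).  The bound on the quotient
    comes from the only analytic step: over an orthogonal complement, the
    infimum of the Rayleigh quotient is attained, at an eigenvector
    (rayleigh_quotient_attained).  The operator T itself is never built: its
    value at us is (us - w) / lams. *)

(** * Symmetric bilinear forms *)

Section SymmetricForms.
Variables (R : realType) (V : lmodType R) (f : {symmetric V}).
Implicit Types u v x : V.

Lemma symC u v : f u v = f v u.
Proof. by rewrite hermC expr0 mul1r. Qed.

Lemma symDl u v x : f (u + v) x = f u x + f v x.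
Proof. exact: linearDl. Qed.

Lemma symDr u v x : f x (u + v) = f x u + f x v.
Proof. exact: linearDr. Qed.

Lemma symBl u v x : f (u - v) x = f u x - f v x.
Proof. exact: linearBl. Qed.

Lemma symBr u v x : f x (u - v) = f x u - f x v.
Proof. exact: linearBr. Qed.

Lemma symZl c u x : f (c *: u) x = c * f u x.
Proof. exact: linearZl_LR. Qed.

Lemma symZr c u x : f x (c *: u) = c * f x u.
Proof. exact: linearZr_LR. Qed.

Lemma sym0l x : f 0 x = 0.
Proof. exact: linear0l. Qed.

Lemma sym0r x : f x 0 = 0.
Proof. exact: linear0r. Qed.

Lemma sym_sumr m (c : 'I_m -> R) (e : 'I_m -> V) x :
  f x (\sum_(i < m) c i *: e i) = \sum_(i < m) c i * f x (e i).
Proof. by rewrite linear_sumr; apply: eq_bigr => i _; exact: symZr. Qed.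

Definition symE := (symBl, symBr, symDl, symDr, symZl, symZr).

End SymmetricForms.

Definition positive_definite (R : realType) (V : lmodType R)
  (f : V -> V -> R) : Prop := forall v : V, v != 0 -> 0 < f v v.

Lemma positive_definite_ge0 (R : realType) (V : lmodType R)
  (f : {symmetric V}) : positive_definite f -> positive_semidefinite f.
Proof.
move=> fpos v; have [->|v0] := eqVneq v 0; first by rewrite sym0l.
exact/ltW/fpos.
Qed.

(** A quadratic polynomial vanishing at 0 changes sign there unless its linear
    coefficient is zero.  At t = - q / m, where m > r, the linear term wins. *)
Lemma linear_coef_eq0 (R : realFieldType) (q r : R) :
  (forall t, 0 <= 2 * t * q + t ^+ 2 * r) -> q = 0.
Proof.
move=> h; set m := `|r| + 1.
have m0 : 0 < m by rewrite ltr_wpDl.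
have rm : r <= m - 1 by rewrite addrK ler_norm.
have := h (- q / m).
have -> : 2 * (- q / m) * q + (- q / m) ^+ 2 * r =
  (q ^+ 2 / m ^+ 2) * (r - 2 * m) by field; rewrite gt_eqF.
have m20 : 0 < m ^+ 2 by exact: exprn_gt0.
move=> hq; apply/eqP; rewrite -sqrf_eq0; apply/eqP.
have : 0 <= q ^+ 2 / m ^+ 2 by rewrite divr_ge0 ?sqr_ge0 ?ltW.
rewrite le_eqVlt => /predU1P[/esym/eqP|qm]; last by move: hq; nra.
by rewrite mulf_eq0 invr_eq0 (gt_eqF m20) orbF => /eqP.
Qed.

(** * Projection onto finitely many eigenspaces *)

Section SpanProjection.
Variables (R : realType) (V : lmodType R) (a : {symmetric V}).
Hypothesis a_pos : positive_definite a.

(** Gram-Schmidt: once the last vector is made orthogonal to the others, the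
    projection gains a single term, along the corrected vector x'. *)
Lemma span_projection m (e : 'I_m -> V) (u : V) :
  exists c : 'I_m -> R, forall j, a (u - \sum_(i < m) c i *: e i) (e j) = 0.
Proof.
elim: m e u => [|m IHm] e u; first by exists (fun=> 0) => -[].
pose e' i := e (widen_ord (leqnSn m) i); pose x := e ord_max.
have [c cP] := IHm e' u; have [d dP] := IHm e' x.
set u' := u - _ in cP; set x' := x - _ in dP.
pose g := a u' x' / a x' x'.
pose c' (i : 'I_m.+1) := if insub (val i) is Some j then c j - g * d j else g.
exists c'; have -> : \sum_(i < m.+1) c' i *: e i =
    \sum_(i < m) c i *: e' i + g *: x'.
  rewrite big_ord_recr /= {2}/c' insubF ?ltnn// /x' scalerBr -/x.
  rewrite [X in _ = _ + X]addrC addrA; congr (_ + _).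
  rewrite scaler_sumr -sumrB; apply: eq_bigr => i _.
  by rewrite /c' /= valK scalerBl scalerA.
rewrite opprD addrA -/u'.
have re i : a (u' - g *: x') (e' i) = 0 by rewrite symBl symZl cP dP mulr0 subrr.
have rx' : a (u' - g *: x') x' = 0.
  rewrite symBl symZl /g.
  (* If x' = 0, then g is a quotient by 0, but both terms vanish. *)
  have [x'0|x'0] := eqVneq x' 0; first by rewrite x'0 !sym0r mulr0 subrr.
  by rewrite divfK ?subrr// gt_eqF// a_pos.
move=> j; have [jm|jm] := ltnP j m.
  by have := re (Ordinal jm); congr (a _ (e _) = 0); exact: val_inj.
have -> : j = ord_max.
  by apply: val_inj; apply/eqP; rewrite eqn_leq jm -ltnS ltn_ord.
have -> : e ord_max = x' + \sum_(i < m) d i *: e' i by rewrite subrK.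
rewrite symDr rx' add0r sym_sumr big1// => i _.
by rewrite re mulr0.
Qed.

Lemma has_dim_projection (E : set V) m : has_dim E m ->
  forall u, exists2 e, E e & forall x, E x -> a (u - e) x = 0.
Proof.
move=> [e [_ ->]] u; have [c cP] := span_projection e u.
exists (\sum_(i < m) c i *: e i); first by exists c.
move=> _ [d _ <-]; rewrite sym_sumr big1// => i _.
by rewrite cP mulr0.
Qed.

End SpanProjection.

Definition orthocomp (R : realType) (V : lmodType R) (a : V -> V -> R)
  (S : set V) : set V := [set u | forall e, S e -> a u e = 0].

Definition eigenvectors (R : realType) (V : lmodType R) (a b : V -> V -> R)
    (mus : seq R) : set V :=
  [set e | exists2 mu, mu \in mus & eig_space a b mu e].

Section Deflation.
Variables (R : realType) (V : lmodType R).
Variables (a b : {symmetric V}).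
Hypothesis a_pos : positive_definite a.

Lemma eig_space_orthogonal mu nu e x : mu != nu ->
  eig_space a b mu e -> eig_space a b nu x -> a e x = 0.
Proof.
move=> munu eP xP; have := xP e; rewrite (symC a) (symC b) eP => /eqP.
by rewrite -subr_eq0 -mulrBl mulf_eq0 subr_eq0 (negPf munu) => /eqP ->; rewrite mulr0.
Qed.

(** Eigenvectors are split off one eigenvalue at a time.  The component removed
    for a new eigenvalue is orthogonal to the eigenspaces of the other ones, so
    it does not spoil the orthogonality already obtained. *)
Lemma deflation_ind (mus : seq R) (P : V -> Prop) :
  (forall mu, mu \in mus -> exists m, has_dim (eig_space a b mu) m) ->
  (forall u, orthocomp a (eigenvectors a b mus) u -> P u) ->
  (forall mu e u, mu \in mus -> eig_space a b mu e ->
    (forall x, eig_space a b mu x -> a u x = 0) -> P u -> P (e + u)) ->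
  forall u, P u.
Proof.
elim: mus => [|mu mus IH] dims P0 PS u; first by apply: P0 => e [].
apply: IH => [nu nus|{}u uW|nu e {}u nus]; last first.
- by apply: PS; rewrite inE nus orbT.
- have [m /(has_dim_projection a_pos)/(_ u)[e eP ue]] := dims _ (mem_head mu mus).
  have -> : u = e + (u - e) by rewrite addrC subrK.
  apply: (PS mu _ _ (mem_head _ _) eP ue); apply: P0.
  move=> x [nu]; rewrite inE; have [-> _|numu /= nus xP] := eqVneq nu mu.
    exact: ue.
  rewrite symBl uW; last by exists nu.
  by rewrite (eig_space_orthogonal (mu := mu) (nu := nu)) ?subrr// eq_sym.
- by apply: dims; rewrite inE nus orbT.
Qed.

End Deflation.

(** * A spectral inequality for a gap *)

Section SpectralInequality.
Variables (R : realType) (V : lmodType R) (a b : {symmetric V}).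
Hypothesis a_pos : positive_definite a.
Hypothesis b_psd : positive_semidefinite b.

Lemma eigenvalue_gt0 mu e : e != 0 -> eig_space a b mu e -> 0 < mu.
Proof.
move=> /a_pos + eP; rewrite eP; have := b_psd e.
by rewrite le_eqVlt => /predU1P[<-|b0]; rewrite ?mulr0 ?ltxx// pmulr_lgt0.
Qed.

(** If T is the operator with a (T u) v = b u v, the claim is that
    (1 - alpha T)(1 - beta T) is positive semidefinite when mus lists the
    eigenvalues up to alpha and the other ones are at least beta.  At an
    eigenvector e of eigenvalue mu the quadratic form is
    (1 - alpha / mu) * (1 - beta / mu) * a e e, with both factors nonpositive if
    mu <= alpha.  On the orthogonal complement of these eigenvectors
    beta T <= 1, and
    (1 - alpha T)(1 - beta T) = alpha / beta * (1 - beta T) ^ 2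
       + (1 - alpha / beta) * (1 - beta T). *)
Lemma spectral_gap_form_ge0 (mus : seq R) (alpha beta : R) :
  0 <= alpha -> alpha <= beta -> 0 < beta ->
  (forall mu, mu \in mus -> exists m, has_dim (eig_space a b mu) m) ->
  (forall mu, mu \in mus -> mu <= alpha) ->
  (forall u, orthocomp a (eigenvectors a b mus) u -> beta * b u u <= a u u) ->
  forall u z, (forall v, a z v = b u v) ->
    0 <= a u u - (alpha + beta) * b u u + alpha * beta * a z z.
Proof.
move=> alpha0 leab beta0 dims le_alpha rayleigh.
apply: (deflation_ind a_pos dims) => [u uW z zP|mu e u mu_in eP ue IH z zP].
  have -> : a u u - (alpha + beta) * b u u + alpha * beta * a z z =
     alpha / beta * a (u - beta *: z) (u - beta *: z) +
     (1 - alpha / beta) * (a u u - beta * b u u).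
    rewrite !symE (symC a u z) (zP u); field; exact: lt0r_neq0.
  have ab1 : alpha / beta <= 1 by rewrite ler_pdivrMr ?mul1r.
  rewrite addr_ge0// mulr_ge0 ?divr_ge0 ?(ltW beta0) ?subr_ge0 ?rayleigh//.
  exact: positive_definite_ge0.
have [e0|e0] := eqVneq e 0.
  by rewrite e0 add0r in zP *; exact: IH.
have mu0 := eigenvalue_gt0 e0 eP; have muN0 := lt0r_neq0 mu0.
have aeu : a e u = 0 by rewrite symC ue.
have beu : b e u = 0 by apply: (mulfI muN0); rewrite -eP aeu mulr0.
pose z' := z - mu^-1 *: e.
have z'P v : a z' v = b u v.
  by rewrite /z' !symE zP eP mulKf// symDl addrC addKr.
have az'e : a e z' = 0 by rewrite symC z'P symC.
have {zP} -> : z = z' + mu^-1 *: e by rewrite subrK.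
clearbody z'.
have := IH _ z'P; rewrite !symE (symC a u e) (symC b u e) (symC a z' e).
rewrite az'e aeu beu eP.
set A := a u u; set B := b u u; set Z := a z' z'; set E := b e e.
have -> : mu * E + 0 + (0 + A) - (alpha + beta) * (E + 0 + (0 + B)) +
    alpha * beta * (Z + mu^-1 * 0 + (mu^-1 * 0 + mu^-1 * (mu^-1 * (mu * E)))) =
    A - (alpha + beta) * B + alpha * beta * Z +
    E / mu * ((alpha - mu) * (beta - mu)) by field.
move=> h; apply: addr_ge0 => //; have mua := le_alpha _ mu_in.
apply: mulr_ge0; first by rewrite divr_ge0 ?b_psd ?ltW.
by rewrite mulr_ge0 ?subr_ge0// (le_trans mua).
Qed.

End SpectralInequality.

(** * Attainment of the extremal Rayleigh quotient *)

Section RayleighQuotient.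
Variables (R : realType) (V : completeNormedModType R) (a b : {symmetric V}).
Hypothesis a_norm : induces_norm a.
Hypothesis b_cont : continuous_form b.
Hypothesis b_psd : positive_semidefinite b.
Hypothesis b_compact : compact_seminorm b.

Lemma induces_norm_pos : positive_definite a.
Proof.
by move=> v; rewrite -normr_gt0 a_norm /form_norm sqrtr_gt0.
Qed.

Lemma induces_norm_sqr v : a v v = `|v| ^+ 2.
Proof.
by rewrite a_norm /form_norm sqr_sqrtr// (positive_definite_ge0 induces_norm_pos).
Qed.

Lemma continuous_form_cvg T (F : set_system T) (x : T -> V) (l : V) :
  Filter F -> x @ F --> l -> b (x k) (x k) @[k --> F] --> b l l.
Proof.
by move=> FF xl; exact: (continuous2_cvg (h := b) _ (@b_cont (l, l)) xl xl).
Qed.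

(** Polarization reduces this to the continuity of the norm. *)
Lemma inner_product_cvg (x : nat -> V) (l e : V) :
  x @ \oo --> l -> a (x k) e @[k --> \oo] --> a l e.
Proof.
have polar v : a v e = 4^-1 * (`|v + e| ^+ 2 - `|v - e| ^+ 2).
  rewrite -!induces_norm_sqr !symE (symC a e v); by field.
move=> xl; rewrite polar; under eq_fun do rewrite polar.
apply: cvgMr; apply: cvgB; rewrite expr2; under eq_fun do rewrite expr2.
  by apply: cvgM; apply: cvg_norm; apply: cvgD => //; exact: cvg_cst.
by apply: cvgM; apply: cvg_norm; apply: cvgB => //; exact: cvg_cst.
Qed.

(** Near 0 the form is below 1, and vectors of norm d / 2 test every direction. *)
Lemma continuous_form_bounded : exists M : R, forall v, b v v <= M * a v v.
Proof.
have : (fun v : V => b v v) @ (0 : V) --> b 0 0.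
  exact: continuous_form_cvg (@cvg_id _ _).
rewrite sym0l => /cvgrPdist_lt/(_ 1 ltr01)/nbhs_normP[d /= d0 db].
exists ((2 / d) ^+ 2) => v.
have [->|v0] := eqVneq v 0; first by rewrite !sym0l mulr0.
have nv : 0 < `|v| by rewrite normr_gt0.
have := db ((d / 2 / `|v|) *: v); rewrite /ball_ /= !sub0r !normrN normrZ.
rewrite (ger0_norm (b_psd _)) gtr0_norm ?divr_gt0// divfK ?gt_eqF//.
have d2d : d / 2 < d by rewrite ltr_pdivrMr// ltr_pMr// ltr1n.
move=> /(_ d2d).
rewrite symE symZr induces_norm_sqr mulrA -expr2 => h.
rewrite -exprMn.
have -> : (2 / d * `|v|) = (d / 2 / `|v|)^-1.
  by rewrite invf_div invf_div mulrC.
by rewrite exprVn -[leRHS]mul1r ler_pdivlMr ?exprn_gt0 ?divr_gt0// mulrC ltW.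
Qed.

(** Let W be the complement, s the supremum of b v v over the unit ball of W,
    and q = s a - b, which is nonnegative on W.  Along a maximizing sequence q
    tends to 0, and a subsequence is Cauchy for b.  As s a = q + b, it is
    Cauchy for the norm too, so it converges to a zero x of q; being a minimum
    of q on W, x is q-orthogonal to W, that is, mu = 1 / s is its eigenvalue on
    W.  Since W is only an orthogonal complement, the eigenvalue equation is
    obtained against W; it extends to the whole space when S consists of
    eigenvectors whose span admits projections. *)
Lemma rayleigh_quotient_attained (S : set V) (u : V) :
  orthocomp a S u -> 0 < b u u ->
  exists x mu, [/\ orthocomp a S x, x != 0, mu * b u u <= a u u &
    forall v, orthocomp a S v -> a x v = mu * b x v].
Proof.
set W := orthocomp a S => uW bu.
have WZ c v : W v -> W (c *: v) by move=> vW e eS; rewrite symZl vW ?mulr0.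
have WD v w : W v -> W w -> W (v + w).
  by move=> vW wW e eS; rewrite symDl vW// wW// addr0.
have a_ge0 := positive_definite_ge0 induces_norm_pos.
pose A := [set b v v | v in [set v | W v /\ a v v <= 1]].
have supA : has_sup A.
  split; first by exists 0, 0; rewrite ?sym0l//; split=> [e _|]; rewrite sym0l.
  have [M bM] := continuous_form_bounded; exists `|M| => _ [v [_ v1] <-].
  have := bM v; have := a_ge0 v; have := ler_norm M; have := normr_ge0 M; nra.
pose s := sup A.
have bs v : W v -> b v v <= s * a v v.
  move=> vW; have [->|v0] := eqVneq v 0; first by rewrite !sym0l mulr0.
  have av : 0 < a v v by exact: induces_norm_pos.
  have nv : `|v| != 0 by rewrite normr_eq0.
  have : b (`|v|^-1 *: v) (`|v|^-1 *: v) <= s.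
    apply: (ub_le_sup supA.2); exists (`|v|^-1 *: v) => //; split; first exact: WZ.
    by rewrite symZl symZr induces_norm_sqr expr2 mulKf// mulVf.
  rewrite symZl symZr mulrA -expr2 exprVn -induces_norm_sqr mulrC.
  by rewrite ler_pdivrMr.
have s0 : 0 < s.
  have := bs _ uW; have := a_ge0 u => a0 h.
  by have := lt_le_trans bu h; rewrite le_eqVlt in a0; case/predU1P: a0 => [<-|a0];
    rewrite ?mulr0 ?ltxx// pmulr_lgt0.
pose q v := s * a v v - b v v.
have q_ge0 v : W v -> 0 <= q v by move=> vW; rewrite subr_ge0 bs.
have /choice[x xP] (k : nat) :
    exists v, [/\ W v, a v v <= 1 & s - k.+1%:R^-1 < b v v].
  have k0 : 0 < k.+1%:R^-1 :> R by rewrite invr_gt0.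
  by have [_ [v [vW v1] <-] sv] := sup_adherent k0 supA; exists v.
have [|phi [phi_homo phiC]] := @b_compact x.
  exists 1 => k; have [_ x1 _] := xP k.
  by rewrite -(@ler_pXn2r _ 2)// ?nnegrE// -induces_norm_sqr expr1n.
have phi_ge k : (k <= phi k)%N.
  by elim: k => // k IH; exact: leq_ltn_trans IH (phi_homo _ _ (ltnSn k)).
pose y k := x (phi k).
have yW k : W (y k) by have [] := xP (phi k).
have y_b k : s - harmonic k <= b (y k) (y k).
  have [_ _ h] := xP (phi k); apply: le_trans (ltW h).
  by rewrite lerB// lef_pV2 ?posrE// ler_nat ltnS.
have y_q k : q (y k) <= harmonic k.
  have [_ h1 _] := xP (phi k); rewrite /q lerBlDl -lerBlDr.
  by apply: le_trans (y_b k); rewrite lerB// ler_piMr// ltW.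
(* The parallelogram law for q bounds q (y i - y j), which turns the Cauchy
   property for b into the one for the norm. *)
have y_dist i j : s * `|y i - y j| ^+ 2 <=
    2 * (harmonic i + harmonic j) + b (y i - y j) (y i - y j).
  have := q_ge0 _ (WD _ _ (yW i) (yW j)); have := y_q i; have := y_q j.
  rewrite /q -induces_norm_sqr !symE (symC a (y j) (y i)) (symC b (y j) (y i)).
  lra.
have [l yl] : exists l : V, y @ \oo --> l.
  suff : cvg (y @ \oo) by move=> h; exists (lim (y @ \oo)).
  apply: cauchy_cvg; apply: cauchy_exP => e e0.
  have d0 : 0 < s * e ^+ 2 / 8 by rewrite divr_gt0// mulr_gt0// exprn_gt0.
  have [K1 _ K1P] := near_infty_natSinv_lt (PosNum d0).
  have [|K2 K2P] := phiC (Num.sqrt (s * e ^+ 2 / 8)); first by rewrite sqrtr_gt0.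
  pose K := maxn K1 K2; exists (y K); exists K => // k /= Kk.
  rewrite -ball_normE /=.
  have hK : harmonic K < s * e ^+ 2 / 8 by apply: K1P; exact: leq_maxl.
  have hk : harmonic k < s * e ^+ 2 / 8.
    by apply: K1P; exact: leq_trans (leq_maxl _ _) Kk.
  have : form_norm b (y K - y k) < Num.sqrt (s * e ^+ 2 / 8).
    by apply: K2P; [exact: leq_maxr|exact: leq_trans (leq_maxr _ _) Kk].
  rewrite /form_norm ltr_sqrt// => hb.
  rewrite -(@ltr_pXn2r _ 2)// ?nnegrE ?(ltW e0)// -(ltr_pM2l s0).
  by apply: le_lt_trans (y_dist K k) _; lra.
have lW : W l.
  move=> e eS; have := inner_product_cvg (e := e) yl.
  have -> : (fun k => a (y k) e) = fun=> 0 by apply/funext => k; exact: yW.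
  by move=> h; apply: cvg_unique h (cvg_cst _).
have by_cvg : b (y k) (y k) @[k --> \oo] --> b l l.
  exact: continuous_form_cvg.
have sl : s <= b l l.
  have h : (fun k => s - harmonic k) @ \oo --> s - 0.
    by apply: cvgB; [exact: cvg_cst|exact: cvg_harmonic].
  rewrite subr0 in h; apply: (ler_cvg_to h by_cvg); exact: nearW.
have ql : q l = 0.
  apply/eqP; rewrite eq_le q_ge0// andbT.
  have h : q (y k) @[k --> \oo] --> q l.
    apply: cvgB => //; apply: cvgMr; rewrite induces_norm_sqr expr2.
    under eq_fun do rewrite induces_norm_sqr expr2.
    by apply: cvgM; exact: cvg_norm.
  by apply: (ler_cvg_to h cvg_harmonic); exact: nearW.
exists l, s^-1; split => //.
- by apply: contraTneq sl => ->; rewrite sym0l -ltNge.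
- by rewrite mulrC ler_pdivrMr// mulrC bs.
- move=> v vW; suff : s * a l v - b l v = 0.
    by move/eqP; rewrite subr_eq0 => /eqP <-; rewrite mulKf// gt_eqF.
  apply: (@linear_coef_eq0 _ _ (q v)) => t.
  have -> : 2 * t * (s * a l v - b l v) + t ^+ 2 * q v = q (l + t *: v) - q l.
    by rewrite /q !symE (symC a v l) (symC b v l); ring.
  by rewrite ql subr0; apply: q_ge0; apply: WD => //; exact: WZ.
Qed.

End RayleighQuotient.

(** * Consequences for the ordered eigenvalues *)

Section EigenvalueSequence.
Variables (R : realType) (V : completeNormedModType R) (a b : {symmetric V}).
Hypothesis a_norm : induces_norm a.
Hypothesis b_cont : continuous_form b.
Hypothesis b_psd : positive_semidefinite b.
Hypothesis b_compact : compact_seminorm b.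
Variables (N : option nat) (lam : nat -> R).
Hypothesis lam_eig : eigenvalue_sequence a b N lam.

(** The number of indices with value mu is the dimension of a nonzero
    eigenspace. *)
Lemma eigenvalue_index mu : is_eigenvalue a b mu ->
  exists2 i, eig_index N i & lam i = mu.
Proof.
move=> mu_eig; have [_ _ /(_ _ mu_eig)[m mdim cardm]] := lam_eig.
apply: contrapT => noi; move: cardm.
have -> : [set i | eig_index N i /\ lam i = mu] = set0.
  by apply/seteqP; split=> // i [iN imu]; case: noi; exists i.
rewrite card_eq_sym card_eq0 => /eqP m0.
case: m mdim m0 => [[e [_ eE]] _|m _ m0].
  have [u u0] := mu_eig; rewrite eE => -[c _ uE].
  by rewrite -uE big_ord0 eqxx in u0.
by have : set0 0%N by rewrite -m0 /=.
Qed.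

Lemma eigenvalue_sequence_gt0 i : eig_index N i -> 0 < lam i.
Proof.
have [_ isE _ /isE[e e0 eP]] := lam_eig.
exact: (eigenvalue_gt0 (induces_norm_pos a_norm) b_psd e0 eP).
Qed.

Definition first_eigenvalues k : seq R := [seq lam i | i <- iota 1 k].

Lemma first_eigenvaluesP k mu :
  reflect (exists2 i, (0 < i <= k)%N & mu = lam i) (mu \in first_eigenvalues k).
Proof.
apply: (iffP mapP) => -[i ik ->]; exists i => //; move: ik.
  by rewrite mem_iota add1n ltnS.
by rewrite mem_iota add1n ltnS.
Qed.

Lemma first_eigenvalues_dim k mu : (k = 0)%N \/ eig_index N k ->
  mu \in first_eigenvalues k -> exists m, has_dim (eig_space a b mu) m.
Proof.
move=> kN /first_eigenvaluesP[i /andP[i0 ik] ->].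
have iN : eig_index N i.
  case: kN ik => [->|]; first by rewrite leqNgt i0.
  rewrite /eig_index i0; case: N => // K /andP[_ kK] ik; exact: leq_trans kK.
have [_ isE /(_ _ (isE _ iN))[m mdim _]] := lam_eig.
by exists m.
Qed.

(** A violation would yield an eigenvector orthogonal to the first k
    eigenspaces whose eigenvalue is below beta, hence is one of the first k
    eigenvalues; the vector would then be orthogonal to itself. *)
Lemma rayleigh_ge k beta : (k = 0)%N \/ eig_index N k ->
  (forall i, eig_index N i -> (k < i)%N -> beta <= lam i) ->
  forall u, orthocomp a (eigenvectors a b (first_eigenvalues k)) u ->
    beta * b u u <= a u u.
Proof.
move=> kN beta_le u uW; have a_pos := induces_norm_pos a_norm.
have := b_psd u; rewrite le_eqVlt => /predU1P[<-|bu].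
  by rewrite mulr0; exact: positive_definite_ge0.
have [x [mu [xW x0 muu xP]]] :=
  rayleigh_quotient_attained a_norm b_cont b_psd b_compact uW bu.
have xE : eig_space a b mu x.
  (* Against an eigenvector of one of the first k eigenvalues, both sides of
     the eigenvalue equation vanish. *)
  apply: (deflation_ind a_pos (fun nu => first_eigenvalues_dim kN)) xP _.
  move=> nu e v nu_in eP _ vP; rewrite !symDr vP mulrDr; congr (_ + _).
  have xe : a x e = 0 by apply: xW; exists nu.
  have [->|e0] := eqVneq e 0; first by rewrite !sym0r mulr0.
  have nu0 := eigenvalue_gt0 a_pos b_psd e0 eP.
  have : nu * b e x = 0 by rewrite -eP symC.
  move/eqP; rewrite mulf_eq0 (gt_eqF nu0) /= => /eqP bex.
  by rewrite xe symC bex mulr0.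
have [i iN lami] : exists2 i, eig_index N i & lam i = mu.
  by apply: eigenvalue_index; exists x.
have ki : (k < i)%N.
  rewrite ltnNge; apply/negP => ik; have := a_pos _ x0.
  rewrite xW ?ltxx//; exists mu => //; apply/first_eigenvaluesP; exists i => //.
  by rewrite ik andbT; case/andP: iN.
apply: le_trans muu; rewrite ler_wpM2r ?(ltW bu)//.
by rewrite -lami beta_le.
Qed.

(** The defect of an approximate eigenpair controls the relative distance of t
    to lam n: here w = u - t T u, and with alpha and beta the two numbers
    lam n and t ^ 2 / lam n in increasing order, a w w is
    (lam n - t) ^ 2 / lam n * b u u plus the form of spectral_gap_form_ge0.
    The two closeness hypotheses say that no eigenvalue lies strictly between
    alpha and beta. *)
Lemma defect_ge n t u w : eig_index N n -> 0 < t ->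
  (eig_index N n.-1 -> lam n.-1 * lam n <= t ^+ 2) ->
  (eig_index N n.+1 -> t ^+ 2 <= lam n * lam n.+1) ->
  (forall v, a w v = a u v - t * b u v) ->
  (lam n - t) ^+ 2 * b u u <= lam n * a w w.
Proof.
move=> nN t0 lower upper wP; have ln0 := eigenvalue_sequence_gt0 nN.
have lnN0 := lt0r_neq0 ln0; have tN0 := lt0r_neq0 t0.
have [mono _ _] := lam_eig; have a_pos := induces_norm_pos a_norm.
pose z := t^-1 *: (u - w).
have zP v : a z v = b u v.
  by rewrite symZl symBl wP opprB addrC subrK mulKf.
have wE : w = u - t *: z by rewrite scalerA divff// scale1r subKr.
clearbody z; pose nu := t ^+ 2 / lam n.
have nu0 : 0 < nu by rewrite divr_gt0// exprn_gt0.
suff h : 0 <= a u u - (lam n + nu) * b u u + lam n * nu * a z z.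
  rewrite wE !symE (symC a u z) (zP u).
  have := mulr_ge0 (ltW ln0) h.
  have -> : lam n * (a u u - (lam n + nu) * b u u + lam n * nu * a z z) =
    lam n * (a u u - t * b u u - (t * b u u - t * (t * a z z))) -
    (lam n - t) ^+ 2 * b u u by rewrite /nu; field.
  by rewrite subr_ge0.
have gap k alpha beta : (k = 0)%N \/ eig_index N k ->
    0 < alpha -> alpha <= beta ->
    (eig_index N k -> lam k <= alpha) ->
    (forall i, eig_index N i -> (k < i)%N -> beta <= lam i) ->
    0 <= a u u - (alpha + beta) * b u u + alpha * beta * a z z.
  move=> kN alpha0 leab lek gek; apply: (spectral_gap_form_ge0 a_pos b_psd
    (ltW alpha0) leab (lt_le_trans alpha0 leab) _ _ (rayleigh_ge kN gek) zP).
    by move=> mu; exact: first_eigenvalues_dim.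
  move=> mu /first_eigenvaluesP[i /andP[i0 ik] ->].
  case: kN => [k0|kN]; first by rewrite k0 leqNgt i0 in ik.
  apply: le_trans (lek kN); apply: mono => //.
  rewrite /eig_index i0; move: kN; rewrite /eig_index.
  by case: (N) => // K /andP[_]; exact: leq_trans.
have [ln_nu|/ltW nu_ln] := leP (lam n) nu.
  apply: (gap n) => //; first by right.
  move=> i iN ni; have nN1 : eig_index N n.+1.
    move: iN; rewrite /eig_index; case: (N) => // K /andP[_].
    exact: leq_trans.
  apply: le_trans (mono _ _ nN1 iN ni).
  by rewrite ler_pdivrMr// mulrC upper.
rewrite (addrC (lam n)) (mulrC (lam n) nu); apply: (gap n.-1) => //.
- have [->|n1] := posnP n.-1; [by left|right].
  move: nN; rewrite /eig_index n1; case: (N) => // K /andP[_].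
  exact: leq_trans (leq_pred n).
- by move=> n1N; rewrite ler_pdivlMr// lower.
- by move=> i iN ni; apply: mono => //; rewrite (leq_trans (leqSpred n)).
Qed.

End EigenvalueSequence.

(** * Solving for the lower bound *)

(** The bound is the square of the nonnegative root X of X ^ 2 + eta X = t, while
    Num.sqrt l makes the left-hand side of that equation at least t. *)
Lemma quadratic_root_sqr_le (R : realType) (l t eta : R) :
  0 <= t -> 0 <= eta -> 0 <= l -> t <= l + eta * Num.sqrt l ->
  4^-1 * (- eta + Num.sqrt (eta ^+ 2 + 4 * t)) ^+ 2 <= l.
Proof.
move=> t0 eta0 l0 tl.
set r := Num.sqrt l in tl; have r0 : 0 <= r by exact: sqrtr_ge0.
have lE : l = r ^+ 2 by rewrite sqr_sqrtr.
set s := Num.sqrt _; have s0 : 0 <= s by exact: sqrtr_ge0.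
have sE : s ^+ 2 = eta ^+ 2 + 4 * t.
  by rewrite sqr_sqrtr// addr_ge0 ?sqr_ge0// mulr_ge0.
have s_ge : eta <= s.
  by rewrite -(@ler_pXn2r _ 2)// ?nnegrE// sE lerDl mulr_ge0.
have s_le : s <= eta + 2 * r.
  rewrite -(@ler_pXn2r _ 2)// ?nnegrE ?addr_ge0 ?mulr_ge0//.
  by rewrite sE; move: tl; rewrite lE; lra.
rewrite lE; nra.
Qed.

Lemma sqrte_le_sqr (R : realType) (x y t : R) : 0 <= t ->
  (sqrte (x%:E * y%:E) <= t%:E)%E -> x * y <= t ^+ 2.
Proof.
rewrite -EFinM /= lee_fin => t0 h.
have [xy0|xy0] := leP 0 (x * y); last by rewrite (le_trans (ltW xy0))// sqr_ge0.
by rewrite -(sqr_sqrtr xy0) ler_pXn2r// nnegrE// sqrtr_ge0.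
Qed.

Lemma sqrte_ge_sqr (R : realType) (x y t : R) : 0 <= t -> 0 <= x * y ->
  (t%:E <= sqrte (x%:E * y%:E))%E -> t ^+ 2 <= x * y.
Proof.
rewrite -EFinM /= lee_fin => t0 xy0 h.
by rewrite -(sqr_sqrtr xy0) ler_pXn2r// nnegrE// sqrtr_ge0.
Qed.

Theorem theorem2p3 (R : realType) (V : completeNormedModType R)
    (a : {dot V for idfun}) (b : {symmetric V})
    (a_norm : induces_norm a)
    (b_cont : continuous_form b)
    (b_psd : positive_semidefinite b)
    (b_compact : compact_seminorm b)
    (N : option nat) (lam : nat -> R)
    (lam_eig : eigenvalue_sequence a b N lam)
    (n : nat) (n_index : eig_index N n)
    (us : V) (us_norm : form_norm b us = 1)
    (lams : R)
    (lams_lower : (sqrte (ext_eigenvalue N lam n.-1 * ext_eigenvalue N lam n)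
                   <= lams%:E)%E)
    (lams_upper : (lams%:E <=
                   sqrte (ext_eigenvalue N lam n * ext_eigenvalue N lam n.+1))%E)
    (w : V) (w_def : forall v : V, a w v = a us v - lams * b us v)
    (eta : R) (w_eta : `|w| <= eta) :
  4^-1 * (- eta + Num.sqrt (eta ^+ 2 + 4 * lams)) ^+ 2 <= lam n.
Proof.
have extE i : eig_index N i -> ext_eigenvalue N lam i = (lam i)%:E.
  by rewrite /ext_eigenvalue => iN; rewrite iN; case/andP: iN; case: i.
have ln0 := eigenvalue_sequence_gt0 a_norm b_psd lam_eig n_index.
have lams0 : 0 <= lams.
  by rewrite -lee_fin; apply: le_trans lams_lower; exact: sqrte_ge0.
have eta0 : 0 <= eta by exact: le_trans w_eta.
apply: quadratic_root_sqr_le => //; first exact: ltW.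
move: lams0; rewrite le_eqVlt => /predU1P[<-|lams0].
  by rewrite addr_ge0 ?mulr_ge0 ?sqrtr_ge0// ltW.
have : (lam n - lams) ^+ 2 * b us us <= lam n * a w w.
  apply: (defect_ge a_norm b_cont b_psd b_compact lam_eig) => //.
    move=> n1; apply: sqrte_le_sqr; first exact: ltW.
    by rewrite -!extE.
  move=> n1; apply: sqrte_ge_sqr; first exact: ltW.
    by rewrite mulr_ge0 ?ltW// (eigenvalue_sequence_gt0 a_norm b_psd lam_eig).
  by rewrite -!extE.
have -> : b us us = 1 by rewrite -(sqr_sqrtr (b_psd us)) [Num.sqrt _]us_norm expr1n.
rewrite mulr1 (induces_norm_sqr a_norm) => h.
have w2 : `|w| ^+ 2 <= eta ^+ 2 by rewrite ler_pXn2r ?nnegrE.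
have {}h : `|lams - lam n| <= eta * Num.sqrt (lam n).
  rewrite -(@ler_pXn2r _ 2)// ?nnegrE ?mulr_ge0 ?sqrtr_ge0//.
  rewrite real_normK ?num_real// exprMn sqr_sqrtr ?(ltW ln0)//.
  rewrite -[(lams - lam n) ^+ 2]sqrrN opprB.
  by apply: le_trans h _; rewrite mulrC ler_pM2r.
by rewrite -lerBlDl (le_trans (ler_norm _) h).
Qed.
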